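(* Let $N\ge 1$ be an integer, let $b_i>0$, $c_i>0$ be real numbers, let $\tau_i\ge 1$ ($1\le i\le N$) and $\bar\tau\ge 0$ be integers, and let $\sigma_i=\sum_{j=1}^{i-1}\tau_j$. Consider the linear-quadratic control problem $$\min_{y,u}\ \sum_{t=0}^\infty\sum_{i=1}^N\Big(q_iy_i[t]^2+r_iu_i[t]^2+\rho_i(u_i[t+1]-u_i[t])^2\Big)$$ subject to, for $1\le i\le N$ and $t\ge 0$, $$y_i[t+1]=y_i[t]+b_iu_i[t-\tau_i-\bar\tau]-c_i\big(u_{i-1}[t-\bar\tau]-d_i[t-\bar\tau]\big),\qquad u_0\equiv 0,$$ where the initial levels $y_i[0]$, the inputs $u_i[s]$ at times $s<0$, and the disturbances $d_i[s]$ at all (past and future) times are given real numbers. Assume $q_i>0$ for all $i$, $r_i=0$ for $i\ne N$, $r_N=r>0$, and $\rho_i=0$ for all $i$. Let $t\ge 0$ and assume that, for a fixed integer $H>0$, $d_i[s]=0$ for all $s>t+H$ and all $i$. Then the minimizing inputs $u_1[t],\dots,u_N[t]$ are those produced by Algorithm 2 (see context), run at time $t$ with the parameters computed by Algorithm 1 (see context), with the levels $y_i[t]$ and the past inputs $u_i[t-s]$, $s\ge1$, being those of the minimizing trajectory. Explicitly, with the quantities $\hat b_i,\hat q_i,\hat r,\gamma_i,X,g$ from Algorithm 1 and $p_i[t],m_i[t],D_i$ from Algorithm 2, $$u_{i-1}[t]=\frac1{\hat b_{i-1}}\Big[\Big(1-\frac{\gamma_i}{\hat q_i}\Big)p_i[t]-\frac{\gamma_i}{\hat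 q_i}\,m_{i-1}[t]\Big],\qquad 2\le i\le N,$$ $$u_N[t]=-\frac{1}{\hat b_N}\,\frac{X}{\hat r}\Big[m_N[t]+\sum_{s=\tau_N+1}^{H}g^{\,s-\tau_N}\,D_N[t+\sigma_N+s]\Big].$$
   Context: The setting is a string of $N$ pools (pool $N$ is the most upstream, fed by a reservoir through $u_N$); $y_i$ is the level of pool $i$, $u_i$ is the flow into pool $i$, $u_{i-1}$ is the flow out of pool $i$ (with $u_0\equiv0$), and $d_i$ is a planned (known) disturbance in pool $i$. Empty sums are $0$. Algorithm 1 (parameters; one sweep $i=1,\dots,N$). Input: $q_i$, $r=r_N$, $b_i$, $c_i$. - $\hat b_1=b_1$, $\hat q_1=q_1$, $\gamma_1=q_1$. - For $i=2,\dots,N$: $\hat b_i=\frac{b_i}{c_i}\hat b_{i-1}$, $\ \hat q_i=\frac{c_i^2}{\hat b_{i-1}^2}q_i$, $\ \gamma_i=\frac{\gamma_{i-1}\hat q_i}{\gamma_{i-1}+\hat q_i}$. - $\hat r=r/\hat b_N^2$, $\ X=-\frac{\gamma_N}{2}+\sqrt{\gamma_N\hat r+\frac{\gamma_N^2}{4}}$, $\ g=\frac{X}{X+\gamma_N}$. Algorithm 2 (control law at time $t$; one sweep $i=1,\dots,N$). Input: levels $y_i[t]$, the disturbances, the stored past inputs, and the output of Algorithm 1. - Scaling: $\hat y_1=y_1$ and $\hat y_i=\frac{\hat b_{i-1}}{c_i}y_i$ for $i\ge2$; $\hat d_1=c_1d_1$ and $\hat d_i=\hat b_{i-1}d_i$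 for $i\ge 2$; $\hat u_i=\hat b_iu_i$ for $1\le i\le N$. - Aggregated disturbances: $D_1[s]=\hat d_1[s]$ and $D_i[s]=D_{i-1}[s]+\hat d_i[s-\sigma_i]$ for $i\ge2$, i.e. $D_i[s]=\sum_{j=1}^i\hat d_j[s-\sigma_j]$. - $m_1[t]=\hat y_1[t]+\sum_{s=1}^{\tau_1+\bar\tau}\hat u_1[t-s]+\sum_{s=1}^{\bar\tau}\hat d_1[t-s]+\sum_{s=0}^{\tau_1}D_1[t+\sigma_1+s]$. - For $i=2,\dots,N$: $$p_i[t]=\hat y_i[t]+\sum_{s=\tau_i}^{\tau_i+\bar\tau}\hat u_i[t-s]-\sum_{s=1}^{\bar\tau}\hat u_{i-1}[t-s]+\sum_{s=0}^{\bar\tau}\hat d_i[t-s],$$ $$m_i[t]=m_{i-1}[t]+p_i[t]+\sum_{s=1}^{\tau_i-1}\hat u_i[t-s]+\sum_{s=1}^{\tau_i}D_i[t+\sigma_i+s].$$ - Scaled inputs: $\hat u_{i-1}[t]=(1-\gamma_i/\hat q_i)p_i[t]-(\gamma_i/\hat q_i)m_{i-1}[t]$ for $2\le i\le N$, and $\hat u_N[t]=-\frac{X}{\hat r}\big[m_N[t]+\sum_{s=\tau_N+1}^{H}g^{\,s-\tau_N}D_N[t+\sigma_N+s]\big]$. - Output: $u_i[t]=\hat u_i[t]/\hat b_i$ for $1\le i\le N$. *)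

(* Defs.v *)
From HB Require Import structures.
From mathcomp Require Import all_boot all_order all_algebra.
From mathcomp Require Import all_classical all_reals all_analysis.

Set Implicit Arguments.
Unset Strict Implicit.
Unset Printing Implicit Defensive.

Import Order.TTheory GRing.Theory Num.Theory.

Local Open Scope ring_scope.

(* Pools are numbered 1, ..., N as natural numbers; a family indexed by pools
   is a function on nat of which only the values at 1, ..., N are meaningful
   (and, for the inputs, the value at 0, which is the zero input u_0).
   Levels are indexed by times in nat; inputs and disturbances, which are also
   needed in the past, by times in int. *)

Record pool_string (R : realType) := PoolString {
  nb_pools : nat;
  b_ : nat -> R;
  c_ : nat -> R;
  tau_ : nat -> nat;
  taubar : nat;
  q_ : nat -> R;
  r_ : nat -> R;
  rho_ : nat -> R
}.

Definition sigma (R : realType) (P : pool_string R) (i : nat) : nat :=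
  (\sum_(1 <= j < i) tau_ P j)%N.

Definition feasible (R : realType) (P : pool_string R)
    (y0 : nat -> R) (upast d : nat -> int -> R)
    (y : nat -> nat -> R) (u : nat -> int -> R) : Prop :=
  [/\ forall s : int, u 0%N s = 0,
      forall i : nat, (1 <= i <= nb_pools P)%N -> y i 0%N = y0 i,
      forall (i : nat) (s : int),
        (1 <= i <= nb_pools P)%N -> s < 0 -> u i s = upast i s
    & forall i t : nat, (1 <= i <= nb_pools P)%N ->
        y i t.+1 = y i t
          + b_ P i * u i (t%:Z - (tau_ P i)%:Z - (taubar P)%:Z)
          - c_ P i * (u i.-1 (t%:Z - (taubar P)%:Z)
                      - d i (t%:Z - (taubar P)%:Z))].

Definition stage_cost (R : realType) (P : pool_string R)
    (y : nat -> nat -> R) (u : nat -> int -> R) (t : nat) : R :=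
  \sum_(1 <= i < (nb_pools P).+1)
    (q_ P i * y i t ^+ 2 + r_ P i * u i t%:Z ^+ 2
     + rho_ P i * (u i t.+1%:Z - u i t%:Z) ^+ 2).

(* Extended-real valued, so that a divergent cost is +oo. *)
Definition total_cost (R : realType) (P : pool_string R)
    (y : nat -> nat -> R) (u : nat -> int -> R) : \bar R :=
  (\sum_(0 <= t <oo) (stage_cost P y u t)%:E)%E.

Definition minimizing (R : realType) (P : pool_string R)
    (y0 : nat -> R) (upast d : nat -> int -> R)
    (y : nat -> nat -> R) (u : nat -> int -> R) : Prop :=
  feasible P y0 upast d y u /\
  forall (y' : nat -> nat -> R) (u' : nat -> int -> R),
    feasible P y0 upast d y' u' ->
    (total_cost P y u <= total_cost P y' u')%E.

(* In bhat, gamma and m_ the value at i = 0 is a dummy.  The scalings bhat,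
   yhat, uhat, dhat turn the dynamics into the unit-gain form
     yhat_i[t+1] = yhat_i[t] + uhat_i[t - tau_i - taubar]
                   - uhat_(i-1)[t - taubar] + dhat_i[t - taubar]   (uhat_0 = 0),
   with stage cost sum_i qhat_i yhat_i^2 + rhat uhat_N^2. *)

Fixpoint bhat (R : realType) (P : pool_string R) (i : nat) : R :=
  match i with
  | 0 => 0
  | 1 => b_ P 1
  | j.+1 => b_ P j.+1 / c_ P j.+1 * bhat P j
  end.

Definition qhat (R : realType) (P : pool_string R) (i : nat) : R :=
  if i == 1%N then q_ P 1 else c_ P i ^+ 2 / bhat P i.-1 ^+ 2 * q_ P i.

(* gamma_i z^2 is the minimum of sum_(j <= i) qhat_j z_j^2 subject to
   sum_(j <= i) z_j = z. *)
Fixpoint gamma (R : realType) (P : pool_string R) (i : nat) : R :=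
  match i with
  | 0 => 0
  | 1 => q_ P 1
  | j.+1 => gamma P j * qhat P j.+1 / (gamma P j + qhat P j.+1)
  end.

Definition rhat (R : realType) (P : pool_string R) : R :=
  r_ P (nb_pools P) / bhat P (nb_pools P) ^+ 2.

(* Xpar + gamma_N is the positive solution S of the scalar Riccati equation
   S = gamma_N + S - S^2 / (rhat + S). *)
Definition Xpar (R : realType) (P : pool_string R) : R :=
  let gN := gamma P (nb_pools P) in
  - (gN / 2) + Num.sqrt (gN * rhat P + gN ^+ 2 / 4).

Definition gpar (R : realType) (P : pool_string R) : R :=
  Xpar P / (Xpar P + gamma P (nb_pools P)).

Definition yhat (R : realType) (P : pool_string R)
    (y : nat -> nat -> R) (i t : nat) : R :=
  if i == 1%N then y 1%N t else bhat P i.-1 / c_ P i * y i t.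

Definition dhat (R : realType) (P : pool_string R)
    (d : nat -> int -> R) (i : nat) (s : int) : R :=
  if i == 1%N then c_ P 1 * d 1%N s else bhat P i.-1 * d i s.

Definition uhat (R : realType) (P : pool_string R)
    (u : nat -> int -> R) (i : nat) (s : int) : R :=
  bhat P i * u i s.

(* Closed form of D_1 = dhat_1, D_i[s] = D_(i-1)[s] + dhat_i[s - sigma_i]. *)
Definition Dagg (R : realType) (P : pool_string R)
    (d : nat -> int -> R) (i : nat) (s : int) : R :=
  \sum_(1 <= j < i.+1) dhat P d j (s - (sigma P j)%:Z).

(* p and m only involve the inputs u at times strictly before t. *)

Definition p_ (R : realType) (P : pool_string R) (d : nat -> int -> R)
    (y : nat -> nat -> R) (u : nat -> int -> R) (t i : nat) : R :=
  yhat P y i t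
  + \sum_(tau_ P i <= s < (tau_ P i + taubar P).+1) uhat P u i (t%:Z - s%:Z)
  - \sum_(1 <= s < (taubar P).+1) uhat P u i.-1 (t%:Z - s%:Z)
  + \sum_(0 <= s < (taubar P).+1) dhat P d i (t%:Z - s%:Z).

Fixpoint m_ (R : realType) (P : pool_string R) (d : nat -> int -> R)
    (y : nat -> nat -> R) (u : nat -> int -> R) (t i : nat) : R :=
  match i with
  | 0 => 0
  | 1 =>
      yhat P y 1 t
      + \sum_(1 <= s < (tau_ P 1 + taubar P).+1) uhat P u 1 (t%:Z - s%:Z)
      + \sum_(1 <= s < (taubar P).+1) dhat P d 1 (t%:Z - s%:Z)
      + \sum_(0 <= s < (tau_ P 1).+1)
          Dagg P d 1 (t%:Z + (sigma P 1)%:Z + s%:Z)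
  | j.+1 =>
      m_ P d y u t j + p_ P d y u t j.+1
      + \sum_(1 <= s < tau_ P j.+1) uhat P u j.+1 (t%:Z - s%:Z)
      + \sum_(1 <= s < (tau_ P j.+1).+1)
          Dagg P d j.+1 (t%:Z + (sigma P j.+1)%:Z + s%:Z)
  end.

(* The control law: scaled inputs, then u_alg. The input of pool i < N is
   determined by the quantities of pool i.+1, upstream of it. *)
Definition uhat_alg (R : realType) (P : pool_string R) (H : nat)
    (d : nat -> int -> R) (y : nat -> nat -> R) (u : nat -> int -> R)
    (t i : nat) : R :=
  let N := nb_pools P in
  if i == N then
    - (Xpar P / rhat P) *
      (m_ P d y u t N
       + \sum_((tau_ P N).+1 <= s < H.+1)
           gpar P ^+ (s - tau_ P N) *
           Dagg P d N (t%:Z + (sigma P N)%:Z + s%:Z))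
  else
    (1 - gamma P i.+1 / qhat P i.+1) * p_ P d y u t i.+1
    - gamma P i.+1 / qhat P i.+1 * m_ P d y u t i.

Definition u_alg (R : realType) (P : pool_string R) (H : nat)
    (d : nat -> int -> R) (y : nat -> nat -> R) (u : nat -> int -> R)
    (t i : nat) : R :=
  uhat_alg P H d y u t i / bhat P i.

(* Main.v *)
(* In unit-gain variables, a flow leaving pool i at time s reaches pool i-1 at
   time s + tau_(i-1), so in Z_i[s] = sum_(j <= i) yhat_j[s - sigma_j] all the
   internal flows cancel and Z_i is driven by uhat_i and the disturbances only.
   The flows uhat_1, ..., uhat_(N-1) just distribute Z over the pools, which at
   best costs gamma_N Z_N^2, and what is left is a scalar linear-quadratic
   problem for Z_N with input uhat_N and a known disturbance.

   Optimality of the closed loop of Algorithm 2 is shown without dynamic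
   programming.  Against any other feasible trajectory the cost splits into the
   cost of the closed loop, the cost of the difference, and a cross term; on
   each diagonal the equalised marginal costs turn the cross term into that of
   the scalar problem, which telescopes by the costate recursion
   lambda_t = gamma_N Z_N + lambda_(t+1).  Its boundary term vanishes since the
   costate decays like g^t once the disturbances are zero.  The cost of the
   difference being definite, the minimizer is unique, hence equal to the closed
   loop, and therefore obeys the control law at every time. *)

Require Import Defs.
From HB Require Import structures.
From mathcomp Require Import all_boot all_order all_algebra.
From mathcomp Require Import all_classical all_reals all_analysis.
From mathcomp Require Import zify ring lra.

Import Order.TTheory GRing.Theory Num.Theory.

Local Open Scope ring_scope.

Set Implicit Arguments.
Unset Strict Implicit.
Unset Printing Implicit Defensive.

(** * Reindexing of finite sums *)

Section Sums.
Variable R : realType.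

(** Links the control law, which sums backwards from [t], to the forward sums produced by iterating
    the dynamics. *)
Lemma sum_shift_rev (f : int -> R) (a n : nat) (t : int) :
  \sum_(a <= s < a + n) f (t - s%:Z)
  = \sum_(0 <= k < n) f (t + k%:Z - (a + n)%:Z + 1).
Proof.
rewrite -{1}(add0n a) [X in index_iota _ X]addnC big_addn addnK big_nat_rev /=.
by apply: eq_big_nat => k hk; congr f; lia.
Qed.

Lemma sum_truncated_shift (f : nat -> R) (a n : nat) :
  \sum_(0 <= s < a + n) f (s - a)%N
  = \sum_(0 <= s < a) f 0%N + \sum_(0 <= t < n) f t.
Proof.
rewrite (@big_cat_nat _ _ _ a)//= ?leq_addr//; congr (_ + _).
  by rewrite !big_nat; apply: eq_bigr => s hs; congr f; lia.
rewrite [LHS](big_addn 0 _ a) addKn; apply: eq_bigr => t _; congr f; lia.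
Qed.

Lemma sum_le_homo (f : nat -> R) (m n : nat) : (forall k, 0 <= f k) ->
  (m <= n)%N -> \sum_(0 <= k < m) f k <= \sum_(0 <= k < n) f k.
Proof.
move=> f0 mn; rewrite [leRHS](@big_cat_nat _ _ _ m)//= lerDl.
by rewrite sumr_ge0.
Qed.

End Sums.

(** * Unit-gain dynamics, diagonal sums, and the meaning of [p_] and [m_] *)

Section UnitGain.
Variables (R : realType) (P : pool_string R).
Implicit Types (y z : nat -> nat -> R) (u v d : nat -> int -> R).

Local Notation N := (nb_pools P).
Local Notation T := (taubar P).

(** Stated for arbitrary [z] and [v], so that it also covers the difference of two trajectories,
    with zero disturbance. *)
Definition unit_gain d z v : Prop :=
  (forall s : int, v 0%N s = 0) /\
  forall i t : nat, (1 <= i <= N)%N ->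
    z i t.+1 = z i t + v i (t%:Z - (tau_ P i)%:Z - T%:Z)
      - v i.-1 (t%:Z - T%:Z) + dhat P d i (t%:Z - T%:Z).

(* Truncated subtraction freezes [z j] at its initial value when
   [s < sigma P j]. *)
Definition diag z (i s : nat) : R :=
  \sum_(1 <= j < i.+1) z j (s - sigma P j)%N.

Hypothesis htau : forall i : nat, (1 <= i <= N)%N -> (1 <= tau_ P i)%N.

Lemma sigma_le1 (i : nat) : (i <= 1)%N -> sigma P i = 0%N.
Proof. by move=> hi; rewrite /sigma big_geq. Qed.

Lemma sigmaS (i : nat) : (1 <= i)%N -> sigma P i.+1 = (sigma P i + tau_ P i)%N.
Proof. by move=> hi; rewrite /sigma big_nat_recr. Qed.

Lemma sigma_leS (i : nat) : (sigma P i <= sigma P i.+1)%N.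
Proof.
case: i => [|i]; first by rewrite sigma_le1.
by rewrite (sigmaS (i := i.+1))// leq_addr.
Qed.

Lemma sigma_le (i j : nat) : (i <= j)%N -> (sigma P i <= sigma P j)%N.
Proof.
elim: j => [|j IH]; first by rewrite leqn0 => /eqP ->.
rewrite leq_eqVlt ltnS => /predU1P[->//|/IH] /leq_trans; apply.
exact: sigma_leS.
Qed.

Lemma diag0 z (s : nat) : diag z 0 s = 0.
Proof. by rewrite /diag big_geq. Qed.

Lemma diag_rec z (i s : nat) :
  diag z i.+1 s = diag z i s + z i.+1 (s - sigma P i.+1)%N.
Proof. by rewrite /diag big_nat_recr. Qed.

Lemma Dagg0 d (s : int) : Dagg P d 0 s = 0.
Proof. by rewrite /Dagg big_geq. Qed.

Lemma Dagg_rec d (i : nat) (s : int) :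
  Dagg P d i.+1 s = Dagg P d i s + dhat P d i.+1 (s - (sigma P i.+1)%:Z).
Proof. by rewrite /Dagg big_nat_recr. Qed.

(* Along a diagonal the flows between consecutive pools cancel. *)
Lemma diag_step d z v (i s : nat) : unit_gain d z v ->
  (i <= N)%N -> (sigma P i <= s)%N ->
  diag z i s.+1 = diag z i s + v i (s%:Z - (sigma P i.+1)%:Z - T%:Z)
    + Dagg P d i (s%:Z - T%:Z).
Proof.
move=> [v0 dyn]; elim: i => [|i IH] hi hs.
  by rewrite !diag0 Dagg0 v0 !addr0.
rewrite !diag_rec Dagg_rec IH; [|lia|exact: leq_trans (sigma_leS i) hs].
have -> : (s.+1 - sigma P i.+1 = (s - sigma P i.+1).+1)%N by lia.
rewrite dyn; last by lia.
have -> : (s - sigma P i.+1)%N%:Z - (tau_ P i.+1)%:Z - T%:Z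
  = s%:Z - (sigma P i.+2)%:Z - T%:Z by rewrite (sigmaS (i := i.+1))//; lia.
have -> : (s - sigma P i.+1)%N%:Z - T%:Z
  = s%:Z - (sigma P i.+1)%:Z - T%:Z by lia.
have -> : s%:Z - T%:Z - (sigma P i.+1)%:Z
  = s%:Z - (sigma P i.+1)%:Z - T%:Z by lia.
rewrite /=; ring.
Qed.

Lemma diag_steps d z v (i s n : nat) : unit_gain d z v ->
  (i <= N)%N -> (sigma P i <= s)%N ->
  diag z i (s + n) = diag z i s
    + \sum_(0 <= k < n) v i (s%:Z + k%:Z - (sigma P i.+1)%:Z - T%:Z)
    + \sum_(0 <= k < n) Dagg P d i (s%:Z + k%:Z - T%:Z).
Proof.
move=> hz hi hs; elim: n => [|n IH]; first by rewrite addn0 !big_geq ?addr0.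
rewrite addnS (diag_step hz) ?IH ?(leq_trans hs) ?leq_addr//.
rewrite !big_nat_recr//= PoszD; ring.
Qed.

Lemma level_steps d z v (i t n : nat) : unit_gain d z v -> (1 <= i <= N)%N ->
  z i (t + n)%N = z i t
    + \sum_(0 <= k < n) v i (t%:Z + k%:Z - (tau_ P i)%:Z - T%:Z)
    - \sum_(0 <= k < n) v i.-1 (t%:Z + k%:Z - T%:Z)
    + \sum_(0 <= k < n) dhat P d i (t%:Z + k%:Z - T%:Z).
Proof.
move=> [v0 dyn] hi; elim: n => [|n IH].
  by rewrite addn0 !big_geq ?addr0 ?subr0.
rewrite addnS dyn// IH !big_nat_recr//= PoszD; ring.
Qed.

(** Over [T.+1] steps from [t], the outflow at time [t] is the only one [p_] does not already count:
    [p_] is what the level would be without it. *)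
Lemma p_level d y u (t i : nat) : unit_gain d (yhat P y) (uhat P u) ->
  (1 <= i <= N)%N ->
  yhat P y i (t + T.+1)%N = p_ P d y u t i - uhat P u i.-1 t%:Z.
Proof.
move=> hz hi; rewrite (level_steps _ _ hz hi) /p_.
set z := yhat P y; set v := uhat P u.
rewrite -[(tau_ P i + T).+1]addnS -[X in \sum_(1 <= s < X) _]add1n.
rewrite -[X in \sum_(0 <= s < X) dhat _ _ _ (_ - _)]add0n !sum_shift_rev.
have e1 : \sum_(0 <= k < T.+1) v i (t%:Z + k%:Z - (tau_ P i)%:Z - T%:Z)
  = \sum_(0 <= k < T.+1) v i (t%:Z + k%:Z - (tau_ P i + T.+1)%N%:Z + 1).
  by apply: eq_bigr => k _; congr v; lia.
have e2 : \sum_(0 <= k < T) v i.-1 (t%:Z + k%:Z - (1 + T)%N%:Z + 1)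
  = \sum_(0 <= k < T) v i.-1 (t%:Z + k%:Z - T%:Z).
  by apply: eq_bigr => k _; congr v; lia.
have e3 : \sum_(0 <= k < T.+1) dhat P d i (t%:Z + k%:Z - T%:Z)
  = \sum_(0 <= k < T.+1) dhat P d i (t%:Z + k%:Z - (0 + T.+1)%N%:Z + 1).
  by apply: eq_bigr => k _; congr dhat; lia.
rewrite e1 e2 e3 [\sum_(0 <= k < T.+1) v i.-1 _]big_nat_recr//=.
have -> : t%:Z + T%:Z - T%:Z = t%:Z by lia.
ring.
Qed.

(** Induction along the string. One step beyond the diagonal of the induction hypothesis, the lower
    pools hold [m_] plus the flow decided at [t], and the new pool holds [p_] minus that flow, so it
    cancels; the remaining [tau - 1] steps involve only past inputs and known disturbances. *)
Lemma m_diag d y u (t i : nat) : unit_gain d (yhat P y) (uhat P u) ->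
  (1 <= i <= N)%N ->
  m_ P d y u t i = diag (yhat P y) i (t + T + sigma P i.+1)
    + Dagg P d i (t%:Z + (sigma P i.+1)%:Z).
Proof.
move=> hz; elim: i => [//|[_ h1|i IH hi]].
  have s1 : sigma P 1 = 0%N by rewrite sigma_le1.
  have s2 : sigma P 2 = tau_ P 1 by rewrite sigmaS// s1.
  rewrite /= s2 -addnA (diag_steps _ hz)// ?s1// diag_rec diag0 add0r s1 subn0.
  have D1 s : Dagg P d 1 s = dhat P d 1 s.
    by rewrite Dagg_rec Dagg0 s1 add0r subr0.
  rewrite -[(tau_ P 1 + T).+1]add1n -[T.+1]add1n sum_shift_rev.
  rewrite [X in _ + X + _ = _]sum_shift_rev.
  rewrite s2 -!addrA; congr (_ + (_ + _)).
    by rewrite addnC; apply: eq_bigr => k _; congr uhat; lia.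
  (* The isolated disturbance is the last term of the sum, which is then cut at [T], where past
     disturbances give way to those from time [t] on. *)
  have -> : Dagg P d 1 (t%:Z + (tau_ P 1)%:Z)
    = Dagg P d 1 (t%:Z + (T + tau_ P 1)%N%:Z - T%:Z) by congr Dagg; lia.
  rewrite -(big_nat_recr _ _ (fun k => Dagg P d 1 (t%:Z + k%:Z - T%:Z)))//=.
  rewrite [RHS](@big_cat_nat _ _ _ T 0)//=; last by lia.
  congr (_ + _).
    by apply: eq_bigr => k _; rewrite D1; congr dhat; lia.
  rewrite [RHS](big_addn 0 _ T).
  have -> : ((T + tau_ P 1).+1 - T = 1 + tau_ P 1)%N by lia.
  by apply: eq_bigr => k _; congr Dagg; lia.
have hi2 : (1 <= i.+1 <= N)%N by lia.
have ht := htau hi.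
have es : (t + T + sigma P i.+3 =
  (t + T + sigma P i.+2).+1 + (tau_ P i.+2).-1)%N.
  by rewrite (sigmaS (i := i.+2))//; lia.
have hs2 : (sigma P i.+2 <= (t + T + sigma P i.+2).+1)%N by lia.
rewrite [LHS]/= -/(m_ P d y u t i.+1) IH// es.
rewrite (diag_steps (tau_ P i.+2).-1 hz) //.
rewrite (diag_rec _ i.+1).
rewrite (@diag_step d _ _ i.+1 (t + T + sigma P i.+2) hz); [|lia|];
  last first.
  by rewrite (leq_trans (sigma_leS _))// leq_addl.
have -> : ((t + T + sigma P i.+2).+1 - sigma P i.+2 = t + T.+1)%N by lia.
rewrite (p_level _ hz hi) /=.
have -> : (t + T + sigma P i.+2)%N%:Z - (sigma P i.+2)%:Z - T%:Z = t%:Z by lia.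
have -> : (t + T + sigma P i.+2)%N%:Z - T%:Z = t%:Z + (sigma P i.+2)%:Z by lia.
have e1 : \sum_(1 <= s < tau_ P i.+2) uhat P u i.+2 (t%:Z - s%:Z)
   = \sum_(0 <= k < (tau_ P i.+2).-1) uhat P u i.+2
       ((t + T + sigma P i.+2).+1%:Z + k%:Z - (sigma P i.+3)%:Z - T%:Z).
  rewrite -{1}(prednK ht) -add1n sum_shift_rev.
  by apply: eq_bigr => k _; congr uhat; rewrite (sigmaS (i := i.+2))//; lia.
have e2 : \sum_(1 <= s < (tau_ P i.+2).+1)
      Dagg P d i.+2 (t%:Z + (sigma P i.+2)%:Z + s%:Z)
   = \sum_(0 <= k < (tau_ P i.+2).-1) Dagg P d i.+2
       ((t + T + sigma P i.+2).+1%:Z + k%:Z - T%:Z)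
     + Dagg P d i.+2 (t%:Z + (sigma P i.+3)%:Z).
  rewrite -{1}(prednK ht) big_add1 big_nat_recr//=; congr (_ + _).
    by apply: eq_bigr => k _; congr Dagg; lia.
  by congr Dagg; rewrite (sigmaS (i := i.+2))//; lia.
rewrite e1 e2; ring.
Qed.

(** This is the first diagonal that the input of pool [i] at time [t] reaches, so [m_] is the part
    of its sum settled beforehand. *)
Lemma diag_next d y u (t i : nat) : unit_gain d (yhat P y) (uhat P u) ->
  (1 <= i <= N)%N ->
  diag (yhat P y) i (t + T + sigma P i.+1).+1
  = m_ P d y u t i + uhat P u i t%:Z.
Proof.
move=> hz hi; rewrite m_diag// (diag_step hz); [|lia|]; last first.
  by rewrite (leq_trans (sigma_leS _))// leq_addl.
have -> : (t + T + sigma P i.+1)%N%:Z - (sigma P i.+1)%:Z - T%:Z = t%:Z by lia.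
have -> : (t + T + sigma P i.+1)%N%:Z - T%:Z = t%:Z + (sigma P i.+1)%:Z by lia.
ring.
Qed.

(** The scalar system to which the problem reduces, with state [m_] at pool [N]. *)
Lemma m_next d y u (t : nat) : unit_gain d (yhat P y) (uhat P u) ->
  (1 <= N)%N ->
  m_ P d y u t.+1 N = m_ P d y u t N + uhat P u N t%:Z
    + Dagg P d N (t.+1%:Z + (sigma P N.+1)%:Z).
Proof. by move=> hz hN; rewrite -diag_next ?m_diag ?addSn ?hN ?leqnn. Qed.

End UnitGain.

(** * Previewed disturbances in the law of the top pool *)

Section Optimality.
Variables (R : realType) (P : pool_string R).
Implicit Types (y z : nat -> nat -> R) (u v d : nat -> int -> R).

Local Notation N := (nb_pools P).
Local Notation T := (taubar P).
Local Notation S := (T + sigma P (nb_pools P).+1).+1.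
Local Notation gN := (gamma P (nb_pools P)).
Local Notation X := (Xpar P).
Local Notation rh := (rhat P).
Local Notation g := (gpar P).

Lemma dhat0 (i : nat) (s : int) : dhat P (fun _ _ => 0 : R) i s = 0.
Proof. by rewrite /dhat !mulr0 if_same. Qed.

Lemma Dagg_zero (i : nat) (s : int) : Dagg P (fun _ _ => 0 : R) i s = 0.
Proof. by rewrite /Dagg big1// => j _; rewrite dhat0. Qed.

Lemma Dagg_eq0 d (L : nat) (s : int) :
  (forall (i : nat) (r : int), (1 <= i <= N)%N -> L%:Z < r -> d i r = 0) ->
  L%:Z + (sigma P N)%:Z < s -> Dagg P d N s = 0.
Proof.
move=> hd hs; rewrite /Dagg big_nat big1// => j hj.
have hj1 : (1 <= j <= N)%N by lia.
have hsj : (sigma P j <= sigma P N)%N by apply: sigma_le; lia.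
rewrite /dhat; case: eqP => [j1|_]; rewrite hd ?mulr0 -?j1//; lia.
Qed.

Definition preview d (L t : nat) : R :=
  \sum_((tau_ P N).+1 <= s < L.+1)
    g ^+ (s - tau_ P N) * Dagg P d N (t%:Z + (sigma P N)%:Z + s%:Z).

(** The closed loop needs one horizon valid at all times. Disturbances vanish after the absolute
    time [t + H], so [t + H] serves, and at time [t] the extra terms are zero. *)
Lemma preview_horizon d (t H : nat) :
  (forall (i : nat) (s : int), (1 <= i <= N)%N ->
    (t + H)%N%:Z < s -> d i s = 0) ->
  preview d (t + H) t = preview d H t.
Proof.
move=> hd.
have D0 s : (H < s)%N -> Dagg P d N (t%:Z + (sigma P N)%:Z + s%:Z) = 0.
  by move=> hs; apply: (Dagg_eq0 hd); lia.
rewrite /preview; have [hle|hlt] := leqP (tau_ P N) H.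
  rewrite [LHS](@big_cat_nat _ _ _ H.+1)//=; last by rewrite ltnS leq_addl.
  rewrite [X in _ + X]big_nat [X in _ + X]big1 ?addr0// => s hs.
  by rewrite D0 ?mulr0//; lia.
rewrite [RHS]big_geq; last by lia.
by rewrite big_nat big1// => s hs; rewrite D0 ?mulr0//; lia.
Qed.

(** * Positivity of the parameters and the scalar Riccati equation *)

Hypothesis hN : (1 <= nb_pools P)%N.
Hypothesis hb : forall i : nat, (1 <= i <= nb_pools P)%N -> 0 < b_ P i.
Hypothesis hc : forall i : nat, (1 <= i <= nb_pools P)%N -> 0 < c_ P i.
Hypothesis htau : forall i : nat, (1 <= i <= nb_pools P)%N -> (1 <= tau_ P i)%N.
Hypothesis hq : forall i : nat, (1 <= i <= nb_pools P)%N -> 0 < q_ P i.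
Hypothesis hrN : 0 < r_ P (nb_pools P).

Lemma bhat_gt0 (i : nat) : (1 <= i <= N)%N -> 0 < bhat P i.
Proof.
elim: i => [//|[_ h1|i IH hi]]; first exact: hb.
by rewrite mulr_gt0 ?divr_gt0 ?hb ?hc ?IH//; lia.
Qed.

Lemma qhat_gt0 (i : nat) : (1 <= i <= N)%N -> 0 < qhat P i.
Proof.
rewrite /qhat; case: eqP => [->|/eqP i1] hi; first exact: hq.
have hi1 : (1 <= i.-1 <= N)%N by lia.
by rewrite mulr_gt0 ?divr_gt0 ?exprn_gt0 ?hq ?hc ?bhat_gt0.
Qed.

Lemma gamma_rec (i : nat) : (1 <= i)%N ->
  gamma P i.+1 = gamma P i * qhat P i.+1 / (gamma P i + qhat P i.+1).
Proof. by case: i. Qed.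

Lemma gamma_gt0 (i : nat) : (1 <= i <= N)%N -> 0 < gamma P i.
Proof.
elim: i => [//|[_ h1|i IH hi]]; first exact: hq.
have gi : 0 < gamma P i.+1 by apply: IH; lia.
have qi := qhat_gt0 hi.
by rewrite gamma_rec//; apply: divr_gt0; [exact: mulr_gt0|exact: addr_gt0].
Qed.

Lemma gN_gt0 : 0 < gN.
Proof. by apply: gamma_gt0; rewrite hN leqnn. Qed.

Lemma rhat_gt0 : 0 < rh.
Proof. by rewrite divr_gt0 ?exprn_gt0 ?bhat_gt0 ?hN ?leqnn. Qed.

Lemma qhat_sqr_ge0 (i : nat) (a : R) :
  (1 <= i <= N)%N -> 0 <= qhat P i * a ^+ 2.
Proof. by move=> hi; rewrite mulr_ge0 ?sqr_ge0 ?ltW ?qhat_gt0. Qed.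

Lemma rhat_sqr_ge0 (a : R) : 0 <= rh * a ^+ 2.
Proof. by rewrite mulr_ge0 ?sqr_ge0 ?ltW ?rhat_gt0. Qed.

(** The Riccati equation for [X + gN], expanded in [X]; [Xpar] is its root by completing the
    square. *)
Lemma Xpar_riccati : X ^+ 2 + gN * X = gN * rh.
Proof.
have [hg hr] := (gN_gt0, rhat_gt0).
have hD : 0 <= gN * rh + gN ^+ 2 / 4.
  by rewrite addr_ge0 ?mulr_ge0 ?invr_ge0 ?sqr_ge0 ?ltW.
have := sqr_sqrtr hD; rewrite /Xpar; set w := Num.sqrt _ => hw.
transitivity (w ^+ 2 - gN ^+ 2 / 4); first by field.
by rewrite hw addrK.
Qed.

Lemma Xpar_gt0 : 0 < X.
Proof.
have [hg hr] := (gN_gt0, rhat_gt0).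
rewrite /Xpar addrC subr_gt0 -[ltLHS](@ger0_norm _ (gN / 2)); last by lra.
rewrite -sqrtr_sqr ltr_sqrt; last first.
  by apply: addr_gt0; [exact: mulr_gt0|rewrite divr_gt0 ?exprn_gt0].
have hgr : 0 < gN * rh by rewrite mulr_gt0.
by rewrite -subr_gt0 [ltRHS](_ : _ = gN * rh)//; field.
Qed.

Lemma gpar_ge0 : 0 <= g.
Proof.
have [hg hX] := (ltW gN_gt0, ltW Xpar_gt0).
by apply: divr_ge0 => //; exact: addr_ge0.
Qed.

Lemma gpar_lt1 : g < 1.
Proof.
have [hg hX] := (gN_gt0, Xpar_gt0).
by rewrite ltr_pdivrMr ?mul1r ?ltrDl//; exact: addr_gt0.
Qed.

(** The feedback gain is [1 - g], which makes [g] the closed-loop multiplier of [m_] without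
    disturbances. *)
Lemma Xpar_div_rhat : X / rh = 1 - g.
Proof.
have [[hg hr] hX] := (gN_gt0, rhat_gt0, Xpar_gt0).
have hXg : X + gN != 0 by apply: lt0r_neq0; exact: addr_gt0.
apply: (mulIf (lt0r_neq0 hr)); rewrite divfK ?lt0r_neq0//.
apply: (mulIf hXg); rewrite /gpar.
rewrite (_ : X * (X + gN) = X ^+ 2 + gN * X); last by ring.
by rewrite Xpar_riccati; field.
Qed.

Lemma Xpar_gpar : X * (1 - g) = gN * g.
Proof.
have [hg hX] := (gN_gt0, Xpar_gt0).
by rewrite /gpar; field; apply: lt0r_neq0; exact: addr_gt0.
Qed.

(** * Scaling to unit gain, and optimal distribution along a diagonal *)

Lemma feasible_unit_gain (y0 : nat -> R) up d y u : feasible P y0 up d y u ->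
  unit_gain P d (yhat P y) (uhat P u).
Proof.
move=> [u0 _ _ dyn]; split=> [s|i t hi]; first by rewrite /uhat u0 mulr0.
rewrite /yhat /dhat /uhat; case: eqP => [i1|/eqP i1]; rewrite dyn//.
  by rewrite i1 /= u0; ring.
case: i i1 hi dyn => [//|[//|i]] _ hi dyn /=.
have := hc hi => hci.
by field; rewrite gt_eqF.
Qed.

(** First-order condition for sharing a diagonal sum among the pools. It starts at time [T.+1], the
    first at which a level feels an outflow chosen at a time [>= 0]. *)
Definition stationary z : Prop := forall i t : nat, (2 <= i <= N)%N ->
  qhat P i * z i (t + T.+1)%N = gamma P i * diag P z i (t + T.+1 + sigma P i).

(** Since [1 / gamma_(i+1) = 1 / gamma_i + 1 / qhat_(i+1)], removing the share of pool [i.+1] leaves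
    the marginal cost of the diagonal unchanged. *)
Lemma stationary_diag z (i s : nat) : stationary z -> (1 <= i < N)%N ->
  (T.+1 + sigma P i.+1 <= s)%N ->
  qhat P i.+1 * z i.+1 (s - sigma P i.+1)%N = gamma P i.+1 * diag P z i.+1 s /\
  gamma P i * diag P z i s = gamma P i.+1 * diag P z i.+1 s.
Proof.
move=> st hi hs.
have gi : 0 < gamma P i by apply: gamma_gt0; lia.
have qi : 0 < qhat P i.+1 by apply: qhat_gt0; lia.
have := st i.+1 (s - T.+1 - sigma P i.+1)%N.
have -> : (s - T.+1 - sigma P i.+1 + T.+1 = s - sigma P i.+1)%N by lia.
rewrite subnK; last by lia.
move=> /(_ ltac:(lia)) e; split=> //.
have -> : diag P z i s = diag P z i.+1 s - z i.+1 (s - sigma P i.+1)%N.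
  by rewrite diag_rec addrK.
have -> : z i.+1 (s - sigma P i.+1)%N
    = gamma P i.+1 * diag P z i.+1 s / qhat P i.+1.
  by rewrite -e mulrAC divff ?mul1r ?gt_eqF.
rewrite gamma_rec; last by lia.
by field; rewrite !gt_eqF ?addr_gt0.
Qed.

(* Stationarity equalises the marginal costs along a diagonal, so the first
   variation in the direction [h] only sees the total of [h] on it. *)
Lemma diag_form z h (s : nat) : stationary z ->
  (forall i, (1 <= i < N)%N -> (s < T.+1 + sigma P i.+1)%N ->
    diag P h i s = 0 /\ h i.+1 (s - sigma P i.+1)%N = 0) ->
  forall i, (1 <= i <= N)%N ->
  \sum_(1 <= j < i.+1)
    qhat P j * z j (s - sigma P j)%N * h j (s - sigma P j)%N
  = gamma P i * diag P z i s * diag P h i s.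
Proof.
move=> st hh; elim=> [//|[_ _|i IH hi]].
  by rewrite big_nat1 !diag_rec !diag0 !add0r.
have hi1 : (1 <= i.+1 < N)%N by lia.
rewrite big_nat_recr//= IH; last by lia.
rewrite (diag_rec P h i.+1).
have [hs|hs] := leqP (T.+1 + sigma P i.+2) s.
  by have [-> ->] := stationary_diag st hi1 hs; rewrite -mulrDr.
by have [-> ->] := hh _ hi1 hs; rewrite !mulr0 addr0 mulr0.
Qed.

(** Adding a pool loses exactly the square [(c * a - e * b) ^+ 2 / (c + e)], by the parallel-sum
    form of [gamma]. *)
Lemma diag_sqr_le h (i s : nat) : (1 <= i <= N)%N ->
  gamma P i * diag P h i s ^+ 2
  <= \sum_(1 <= j < i.+1) qhat P j * h j (s - sigma P j)%N ^+ 2.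
Proof.
elim: i => [//|[_ h1|i IH hi]]; first by rewrite big_nat1 diag_rec diag0 add0r.
rewrite big_nat_recr// diag_rec gamma_rec//.
have gi : 0 < gamma P i.+1 by apply: gamma_gt0; lia.
have qi := qhat_gt0 hi.
apply: le_trans (lerD (IH _) (lexx _)); last by lia.
set a := diag _ _ _ _; set b := h _ _; set c := gamma _ _ in gi *.
set e := qhat _ _ in qi *.
rewrite -subr_ge0.
have -> : c * a ^+ 2 + e * b ^+ 2 - c * e / (c + e) * (a + b) ^+ 2
  = (c * a - e * b) ^+ 2 / (c + e) by field; rewrite gt_eqF ?addr_gt0.
by rewrite divr_ge0 ?sqr_ge0 ?addr_ge0 ?ltW.
Qed.

(** * Trajectories with zero initial data and zero disturbances *)

Section Homogeneous.
Variables (h : nat -> nat -> R) (v : nat -> int -> R).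
Hypothesis hv : unit_gain P (fun _ _ => 0) h v.
Hypothesis h0 : forall i, (1 <= i <= N)%N -> h i 0%N = 0.
Hypothesis v0 : forall i s, (1 <= i <= N)%N -> s < 0 -> v i s = 0.

Lemma homogeneous_level (i t : nat) :
  (1 <= i <= N)%N -> (t <= T)%N -> h i t = 0.
Proof.
have [vz dyn] := hv; move=> hi; elim: t => [|t IH] ht; first exact: h0.
rewrite dyn// IH ?dhat0; last by lia.
have -> : v i.-1 (t%:Z - T%:Z) = 0.
  by case: i hi {IH} => [//|[_|i hi]]; [exact: vz|apply: v0 => /=; lia].
by rewrite v0 ?addr0 ?subr0//; lia.
Qed.

(** In the induction step, both summands of the new diagonal sum vanish up to [T + sigma P i.+1];
    from there to [T + sigma P i.+2] it is driven only by inputs at negative times. *)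
Lemma homogeneous_diag (i s : nat) : (i <= N)%N -> (s <= T + sigma P i.+1)%N ->
  diag P h i s = 0.
Proof.
elim: i s => [|i IH] s hi hs; first exact: diag0.
have hz r : (r <= T + sigma P i.+1)%N -> diag P h i.+1 r = 0.
  move=> hr; rewrite diag_rec IH ?homogeneous_level ?addr0//; lia.
have [/hz//|hs1] := leqP s (T + sigma P i.+1).
have -> : s = ((T + sigma P i.+1) + (s - (T + sigma P i.+1)))%N by lia.
rewrite (diag_steps _ hv) ?leq_addl// hz// add0r.
rewrite [X in _ + X]big1 ?addr0; last by move=> k _; rewrite Dagg_zero.
rewrite big_nat big1// => k hk; apply: v0; first by lia.
by move: hs; rewrite (@sigmaS _ P i.+1)//; lia.
Qed.

Lemma homogeneous_diag_next (t : nat) :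
  diag P h N (S + t) = diag P h N (T + sigma P N.+1 + t) + v N t%:Z.
Proof.
rewrite addSn (diag_step hv)//; last first.
  by rewrite (leq_trans (sigma_leS _ _))// -addnA addnCA leq_addr.
rewrite Dagg_zero addr0; congr (_ + v N _); lia.
Qed.

End Homogeneous.

(** * Cost accumulated diagonal by diagonal *)

(** Levels are grouped by diagonals, not by times. The input cost at [t] is counted with diagonal
    [S + t], the first that this input reaches, whence the truncated [M - S]. *)
Definition energy z v (M : nat) : R :=
  \sum_(0 <= s < M)
     \sum_(1 <= i < N.+1) qhat P i * z i (s - sigma P i)%N ^+ 2
  + \sum_(0 <= t < M - S) rh * v N t%:Z ^+ 2.

Lemma energy_homo z v : {homo energy z v : m n / (m <= n)%N >-> m <= n}.
Proof.
move=> m n mn; apply: lerD; apply: sum_le_homo; rewrite ?leq_sub2r// => k.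
- rewrite big_nat; apply: sumr_ge0 => i hi; exact: qhat_sqr_ge0.
- exact: rhat_sqr_ge0.
Qed.

Lemma energy_ge0 z v (M : nat) : 0 <= energy z v M.
Proof.
by apply: le_trans (energy_homo _ _ (leq0n M)); rewrite /energy !big_geq ?addr0.
Qed.

Lemma energy_next z v (t : nat) :
  energy z v (S + t).+1 = energy z v (S + t)
  + \sum_(1 <= i < N.+1) qhat P i * z i (S + t - sigma P i)%N ^+ 2
  + rh * v N t%:Z ^+ 2.
Proof.
have e1 : ((S + t).+1 - S = t.+1)%N by lia.
have e2 : (S + t - S = t)%N by lia.
rewrite /energy e1 e2 [\sum_(0 <= k < t.+1) _]big_nat_recr//=.
rewrite [\sum_(0 <= k < (S + t).+1) _]big_nat_recr//=; ring.
Qed.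

(** The costate in closed form, so that its recursion becomes a lemma, [costate_rec]. *)
Definition costate d y u (L t : nat) : R :=
  X * (m_ P d y u t N + preview d L t).

(** * The closed loop of the control law *)

Section ClosedLoop.
Variables (d : nat -> int -> R) (L : nat).
Hypothesis hd : forall (i : nat) (s : int), (1 <= i <= N)%N ->
  L%:Z < s -> d i s = 0.

(** Terms past [L] vanish, so the upper limit is free; [preview_rec] takes one more term at [t] than
    at [t.+1]. *)
Lemma preview_sum (t n : nat) : (L <= n)%N ->
  preview d L t = \sum_(0 <= k < n)
    g ^+ k.+1 * Dagg P d N (t.+1%:Z + (sigma P N.+1)%:Z + k%:Z).
Proof.
move=> hn; pose F (s : nat) :=
  g ^+ (s - tau_ P N) * Dagg P d N (t%:Z + (sigma P N)%:Z + s%:Z).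
have hF s : (L < s)%N -> F s = 0.
  by move=> hs; rewrite /F (Dagg_eq0 hd) ?mulr0//; lia.
have -> : preview d L t = \sum_((tau_ P N).+1 <= s < (n + (tau_ P N).+1)%N) F s.
  have [hL|hL] := leqP (tau_ P N) L.
    rewrite [RHS](@big_cat_nat _ _ _ L.+1)//=; last by lia.
    rewrite [X in _ + X]big_nat [X in _ + X]big1 ?addr0// => s hs.
    by apply: hF; lia.
  rewrite /preview big_geq; last by lia.
  by rewrite big_nat big1// => s hs; apply: hF; lia.
rewrite [LHS](big_addn 0 _ (tau_ P N).+1) addnK; apply: eq_bigr => k _.
rewrite /F (sigmaS _ hN); congr (_ ^+ _ * Dagg _ _ _ _); lia.
Qed.

Lemma preview_rec (t : nat) :
  preview d L t
  = g * (Dagg P d N (t.+1%:Z + (sigma P N.+1)%:Z) + preview d L t.+1).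
Proof.
rewrite (preview_sum t (leqnSn L)) (preview_sum t.+1 (leqnn L)).
rewrite big_nat_recl// expr1 mulrDr addr0 mulr_sumr; congr (_ + _).
apply: eq_bigr => k _; rewrite mulrA -exprS; congr (_ * Dagg _ _ _ _); lia.
Qed.

Lemma preview_late (t : nat) : (L <= t)%N -> preview d L t = 0.
Proof.
move=> ht; rewrite /preview big_nat big1// => s hs.
by rewrite (Dagg_eq0 hd) ?mulr0//; lia.
Qed.

Variables (y : nat -> nat -> R) (u : nat -> int -> R).
Hypothesis hu : unit_gain P d (yhat P y) (uhat P u).
Hypothesis hlaw : forall i t : nat, (1 <= i <= N)%N ->
  u i t%:Z = u_alg P L d y u t i.

Local Notation lam := (costate d y u L).
Local Notation m t := (m_ P d y u t (nb_pools P)).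
Local Notation xi t := (diag P (yhat P y) (nb_pools P) (S + t)%N).

Lemma uhat_law (i t : nat) : (1 <= i <= N)%N ->
  uhat P u i t%:Z = uhat_alg P L d y u t i.
Proof.
move=> hi; have := bhat_gt0 hi => hbi.
by rewrite /uhat hlaw// /u_alg mulrC divfK ?gt_eqF.
Qed.

(** The flow between pools cancels in the diagonal sum, which is [m_] plus [p_]; stationarity is
    then a linear equation in this flow, solved by the law. *)
Lemma closed_loop_stationary : stationary (yhat P y).
Proof.
case=> [//|[//|i]] t hi; have hi1 : (1 <= i.+1 <= N)%N by lia.
have {}hi : (1 <= i.+2 <= N)%N by lia.
have hqi := qhat_gt0 hi.
rewrite diag_rec addnK.
have -> : (t + T.+1 + sigma P i.+2 = (t + T + sigma P i.+2).+1)%N by lia.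
rewrite (diag_next htau _ hu hi1) (p_level _ hu hi) succnK uhat_law// /uhat_alg.
have -> : (i.+1 == N) = false by lia.
set a := gamma P _; set c := qhat _ _ in hqi *.
by field; rewrite gt_eqF.
Qed.

(** First-order condition of the scalar problem. *)
Lemma costate_input (t : nat) : rh * uhat P u N t%:Z = - lam t.
Proof.
have hr := rhat_gt0.
rewrite uhat_law ?hN ?leqnn// /uhat_alg eqxx /costate -/(preview d L t).
by field; rewrite gt_eqF.
Qed.

Lemma diag_top (t : nat) : xi t = m t + uhat P u N t%:Z.
Proof.
have hNN : (1 <= N <= N)%N by rewrite hN leqnn.
rewrite -(diag_next htau _ hu hNN); congr diag; lia.
Qed.

Lemma costate_rec (t : nat) : lam t = gN * xi t + lam t.+1.
Proof.
have [hX hr] := (Xpar_gt0, rhat_gt0).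
have hgX : g != 0.
  rewrite /gpar; apply: lt0r_neq0; apply: divr_gt0 => //.
  exact: addr_gt0 gN_gt0.
(* The factor [g] is the one that [preview_rec] puts on the next preview. *)
apply: (mulfI hgX).
have e1 : lam t.+1 = X * (xi t + Dagg P d N (t.+1%:Z + (sigma P N.+1)%:Z)
    + preview d L t.+1).
  by rewrite /costate (m_next htau t hu hN) diag_top.
have e2 : g * lam t.+1 = X * (g * xi t + preview d L t).
  by rewrite e1 (preview_rec t); ring.
have e3 : X * preview d L t = g * lam t - X * xi t.
  have -> : g = 1 - X / rh by rewrite Xpar_div_rhat; ring.
  rewrite mulrBl mul1r mulrAC -mulrA -[lam t / rh]opprK.
  have -> : - (lam t / rh) = uhat P u N t%:Z.
    by rewrite -mulNr -costate_input mulrAC divff ?mul1r ?gt_eqF.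
  by rewrite diag_top /costate; ring.
have e4 := Xpar_gpar.
rewrite mulrDr e2 mulrDr e3.
have -> : g * (gN * xi t) = (X * (1 - g)) * xi t by rewrite e4; ring.
ring.
Qed.

Lemma input_late (t : nat) : (L <= t)%N -> uhat P u N t%:Z = - (1 - g) * m t.
Proof.
move=> ht; have hr := rhat_gt0.
apply: (mulfI (lt0r_neq0 hr)); rewrite costate_input /costate preview_late//.
by rewrite -Xpar_div_rhat; field; apply: lt0r_neq0.
Qed.

Lemma m_late (t : nat) : (L <= t)%N -> m t.+1 = g * m t.
Proof.
move=> ht; rewrite (m_next htau t hu hN) (Dagg_eq0 hd); last first.
  by have := sigma_leS P N; lia.
by rewrite input_late//; ring.
Qed.

Lemma costate_late (n : nat) : lam (L + n) = X * m L * g ^+ n.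
Proof.
rewrite /costate preview_late ?leq_addr// addr0 -mulrA; congr (_ * _).
elim: n => [|n IH]; first by rewrite addn0 expr0 mulr1.
by rewrite addnS m_late ?leq_addr// IH exprS; ring.
Qed.

(* [X m^2] is the cost-to-go once the disturbances have vanished. *)
Lemma energy_late (n : nat) :
  energy (yhat P y) (uhat P u) (S + (L + n)) + X * m (L + n)%N ^+ 2
  = energy (yhat P y) (uhat P u) (S + L) + X * m L ^+ 2.
Proof.
elim: n => [|n IH]; first by rewrite addn0.
rewrite -IH addnS m_late ?leq_addr// addnS energy_next.
set t := (L + n)%N.
have hNN : (1 <= N <= N)%N by rewrite hN leqnn.
have -> : \sum_(1 <= i < N.+1) qhat P i * yhat P y i (S + t - sigma P i)%N ^+ 2
    = gN * xi t ^+ 2.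
  rewrite expr2 mulrA.
  rewrite -(diag_form closed_loop_stationary (h := yhat P y) (s := S + t))//.
    by apply: eq_bigr => i _; rewrite expr2 mulrA.
  (* Diagonals from [S] on are late enough for stationarity in every pool, so the exceptional case
     of [diag_form] is contradictory. *)
  move=> i hi hs; suff : (sigma P i.+1 <= sigma P N.+1)%N by lia.
  by apply: sigma_le; lia.
rewrite diag_top input_late ?leq_addr//.
have e1 := Xpar_gpar.
have e2 : rh * (1 - g) = X.
  by rewrite -Xpar_div_rhat mulrCA divff ?mulr1 ?gt_eqF ?rhat_gt0.
have -> : gN * (m t + - (1 - g) * m t) ^+ 2 = gN * g * (g * m t ^+ 2) by ring.
have -> : rh * (- (1 - g) * m t) ^+ 2
    = rh * (1 - g) * ((1 - g) * m t ^+ 2) by ring.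
rewrite e2 -e1; ring.
Qed.

(** * Comparison with another feasible trajectory *)

Section Comparison.
Variables (y' : nat -> nat -> R) (u' : nat -> int -> R).
Hypothesis hu' : unit_gain P d (yhat P y') (uhat P u').
Hypothesis hy0 : forall i, (1 <= i <= N)%N -> yhat P y' i 0%N = yhat P y i 0%N.
Hypothesis hu0 : forall i s, (1 <= i <= N)%N -> s < 0 ->
  uhat P u' i s = uhat P u i s.

Let h (i t : nat) : R := yhat P y' i t - yhat P y i t.
Let v (i : nat) (s : int) : R := uhat P u' i s - uhat P u i s.

Lemma difference_unit_gain : unit_gain P (fun _ _ => 0) h v.
Proof.
have [[v1 dyn1] [v2 dyn2]] := (hu, hu').
split=> [s|i t hi]; first by rewrite /v v1 v2 subrr.
by rewrite /h /v dyn1// dyn2// dhat0; ring.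
Qed.

Let h_init i : (1 <= i <= N)%N -> h i 0%N = 0.
Proof. by move=> hi; rewrite /h hy0// subrr. Qed.

Let v_past i s : (1 <= i <= N)%N -> s < 0 -> v i s = 0.
Proof. by move=> hi hs; rewrite /v hu0// subrr. Qed.

Lemma diagonal_cost_split (s : nat) :
  \sum_(1 <= i < N.+1) qhat P i * yhat P y' i (s - sigma P i)%N ^+ 2
  = \sum_(1 <= i < N.+1) qhat P i * yhat P y i (s - sigma P i)%N ^+ 2
    + \sum_(1 <= i < N.+1) qhat P i * h i (s - sigma P i)%N ^+ 2
    + 2 * (gN * diag P (yhat P y) N s * diag P h N s).
Proof.
have hh := difference_unit_gain.
rewrite -(diag_form closed_loop_stationary (h := h) (s := s)); first last.
- by rewrite hN leqnn.
(* Where a diagonal is too early for stationarity, the difference of the trajectories still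
   vanishes. *)
- move=> i hi hs; split.
    by apply: (homogeneous_diag hh h_init v_past) => //; lia.
  by apply: (homogeneous_level hh h_init v_past); lia.
rewrite mulr_sumr -!big_split /=; apply: eq_bigr => i _.
by rewrite /h; ring.
Qed.

(** Summation by parts: the state cross term is [2 * (lam K - lam K.+1)] times the new diagonal sum
    of [h], the input cross term is [- 2 * lam K] times the increment [v N K] of that sum, and only
    the boundary term survives. *)
Lemma energy_split (K : nat) :
  energy (yhat P y') (uhat P u') (S + K)
  = energy (yhat P y) (uhat P u) (S + K) + energy h v (S + K)
    - 2 * (lam K * diag P h N (T + sigma P N.+1 + K)).
Proof.
have hh := difference_unit_gain.
have hz s : (s <= T + sigma P N.+1)%N -> diag P h N s = 0.
  exact: (homogeneous_diag hh h_init v_past).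
elim: K => [|K IH].
  rewrite !addn0 (hz (T + sigma P N.+1)%N)// !mulr0 subr0.
  rewrite /energy subnn [X in _ + X = _]big_geq// [X in _ = _ + X + _]big_geq//.
  rewrite [X in _ = _ + (_ + X)]big_geq// !addr0 -big_split /= !big_nat.
  apply: eq_bigr => s hs; rewrite diagonal_cost_split hz ?mulr0 ?addr0//; lia.
rewrite addnS !energy_next IH diagonal_cost_split.
have e1 : diag P h N (S + K) = diag P h N (T + sigma P N.+1 + K) + v N K%:Z.
  exact: homogeneous_diag_next.
rewrite addnS -addSn e1.
have e2 := costate_rec K; have e3 := costate_input K.
have e4 : uhat P u' N K%:Z = uhat P u N K%:Z + v N K%:Z by rewrite /v; ring.
have e5 : rh * uhat P u' N K%:Z ^+ 2 = rh * uhat P u N K%:Z ^+ 2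
   + rh * v N K%:Z ^+ 2 + 2 * (- lam K * v N K%:Z) by rewrite e4 -e3; ring.
have e6 : lam K.+1 = lam K - gN * xi K by rewrite e2; ring.
by rewrite e5 e6; ring.
Qed.

(** Young's inequality on the boundary term: [2 * l * e <= gN * e ^+ 2 / 2 + 2 * l ^+ 2 / gN]. Here
    [gN * e ^+ 2] is bounded by the cost of the last diagonal counted in [energy h v (S + K)]. *)
Lemma energy_lower_bound (K : nat) :
  energy (yhat P y) (uhat P u) (S + K) + energy h v (S + K) / 2
  <= energy (yhat P y') (uhat P u') (S + K) + 2 * lam K ^+ 2 / gN.
Proof.
have hg := gN_gt0.
rewrite energy_split; set e := diag _ _ _ _; set l := lam K.
suff he : gN * e ^+ 2 <= energy h v (S + K).
  have : 0 <= (gN * e - 2 * l) ^+ 2 / (2 * gN).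
    by apply: divr_ge0; rewrite ?sqr_ge0// mulr_ge0// ltW.
  have -> : (gN * e - 2 * l) ^+ 2 / (2 * gN)
     = gN * e ^+ 2 / 2 - 2 * (l * e) + 2 * l ^+ 2 / gN.
    by field; apply: lt0r_neq0.
  lra.
have hNN : (1 <= N <= N)%N by rewrite hN leqnn.
apply: le_trans (diag_sqr_le _ _ hNN) _.
apply: le_trans (energy_homo _ _ (_ : ((T + sigma P N.+1 + K).+1 <= S + K)%N));
  last by lia.
rewrite /energy [\sum_(0 <= s < _.+1) _]big_nat_recr//= addrAC lerDr.
rewrite addr_ge0//; apply: sumr_ge0 => k _.
  by rewrite big_nat; apply: sumr_ge0 => i hi; exact: qhat_sqr_ge0.
exact: rhat_sqr_ge0.
Qed.

End Comparison.

End ClosedLoop.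

(** * Diagonal energy against cost accumulated in time *)

Definition unit_stage z v (t : nat) : R :=
  \sum_(1 <= i < N.+1) qhat P i * z i t ^+ 2 + rh * v N t%:Z ^+ 2.

Lemma unit_stage_ge0 z v (t : nat) : 0 <= unit_stage z v t.
Proof.
rewrite addr_ge0 ?rhat_sqr_ge0// big_nat sumr_ge0// => i hi.
exact: qhat_sqr_ge0.
Qed.

(* The diagonals starting before time 0 count the initial levels several
   times, see [diag]. *)
Definition initial_excess z : R :=
  \sum_(1 <= i < N.+1) \sum_(0 <= s < sigma P i) qhat P i * z i 0%N ^+ 2.

(** The first [M] diagonals meet only levels before time [M], besides repeated initial ones. With
    [partial_le_energy] this gives bounds sharing one excess, which cancels between trajectories
    with equal initial levels. *)
Lemma energy_le_partial z v (M : nat) :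
  energy z v M <= initial_excess z + \sum_(0 <= t < M) unit_stage z v t.
Proof.
rewrite /unit_stage big_split addrA; apply: lerD; last first.
  by apply: sum_le_homo => [k|]; [exact: rhat_sqr_ge0|exact: leq_subr].
rewrite exchange_big_nat [X in _ + X]exchange_big_nat -big_split /=.
rewrite !big_nat; apply: ler_sum => i hi.
rewrite -(sum_truncated_shift (fun t => qhat P i * z i t ^+ 2)).
by apply: sum_le_homo => [k|]; [exact: qhat_sqr_ge0|exact: leq_addl].
Qed.

(** [S] exceeds every offset [sigma P i], so [S + n] diagonals cover all levels before time [n]. *)
Lemma partial_le_energy z v (n : nat) :
  initial_excess z + \sum_(0 <= t < n) unit_stage z v t <= energy z v (S + n).
Proof.
rewrite /unit_stage big_split addrA /energy; apply: lerD; last by rewrite addKn.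
rewrite exchange_big_nat [leRHS]exchange_big_nat -big_split /=.
rewrite !big_nat; apply: ler_sum => i hi.
rewrite -(sum_truncated_shift (fun t => qhat P i * z i t ^+ 2)).
apply: (sum_le_homo (f := fun s => qhat P i * z i (s - sigma P i)%N ^+ 2)).
  by move=> k; exact: qhat_sqr_ge0.
have : (sigma P i <= sigma P N.+1)%N by apply: sigma_le; lia.
lia.
Qed.

Lemma unit_stage_eq0 z v : (forall n, energy z v n <= 0) ->
  (forall i t, (1 <= i <= N)%N -> z i t = 0) /\ (forall t : nat, v N t%:Z = 0).
Proof.
move=> en; have hs t : unit_stage z v t <= 0.
  apply: le_trans (en (S + t.+1)); apply: le_trans (partial_le_energy z v t.+1).
  rewrite big_nat_recr//= addrA lerDr addr_ge0//.
    rewrite /initial_excess big_nat sumr_ge0// => i hi.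
    by rewrite sumr_ge0// => s _; exact: qhat_sqr_ge0.
  by rewrite sumr_ge0// => s _; exact: unit_stage_ge0.
have h1 t : 0 <= \sum_(1 <= i < N.+1) qhat P i * z i t ^+ 2.
  by rewrite big_nat sumr_ge0// => i hi; exact: qhat_sqr_ge0.
split=> [i t hi|t].
  have q0 := qhat_gt0 hi; apply/eqP; rewrite -sqrf_eq0; apply/eqP.
  apply: (mulfI (lt0r_neq0 q0)); rewrite mulr0.
  have : \sum_(1 <= j < N.+1) qhat P j * z j t ^+ 2 = 0.
    have := hs t; have := rhat_sqr_ge0 (v N t%:Z); have := h1 t.
    rewrite /unit_stage; lra.
  rewrite big_nat => /eqP; rewrite psumr_eq0; last first.
    by move=> j hj; exact: qhat_sqr_ge0.
  move=> /allP/(_ i); rewrite mem_index_iota => /(_ hi) /implyP/(_ hi)/eqP //.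
have hr := rhat_gt0.
apply/eqP; rewrite -sqrf_eq0; apply/eqP.
apply: (mulfI (lt0r_neq0 hr)); rewrite mulr0.
move: (hs t) (rhat_sqr_ge0 (v N t%:Z)) (h1 t); rewrite /unit_stage; lra.
Qed.

(** * Passage to the extended-real total cost *)

Hypothesis hr0 : forall i : nat, (1 <= i < nb_pools P)%N -> r_ P i = 0.
Hypothesis hrho : forall i : nat, (1 <= i <= nb_pools P)%N -> rho_ P i = 0.

Lemma stage_costE y u (t : nat) :
  stage_cost P y u t = unit_stage (yhat P y) (uhat P u) t.
Proof.
have hNN : (1 <= N <= N)%N by rewrite hN leqnn.
rewrite /stage_cost /unit_stage.
have -> : rh * uhat P u N t%:Z ^+ 2
    = \sum_(1 <= i < N.+1) r_ P i * u i t%:Z ^+ 2.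
  rewrite big_nat_recr//= big_nat big1 ?add0r => [|i hi]; last first.
    by rewrite hr0// mul0r.
  by rewrite /rhat /uhat; have := bhat_gt0 hNN => hbN; field; apply: lt0r_neq0.
rewrite -big_split /= !big_nat; apply: eq_bigr => i hi.
rewrite hrho; last by lia.
rewrite mul0r addr0; congr (_ + _); rewrite /qhat /yhat.
case: eqP => [->//|/eqP i1].
have hi1 : (1 <= i.-1 <= N)%N by lia.
have hbi := bhat_gt0 hi1; have hci := hc (i := i) ltac:(lia).
by field; rewrite !gt_eqF.
Qed.

Lemma partial_le_total y u (n : nat) :
  ((\sum_(0 <= t < n) unit_stage (yhat P y) (uhat P u) t)%:E
   <= total_cost P y u)%E.
Proof.
rewrite -sumEFin /total_cost.
under eq_bigr do rewrite -stage_costE.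
apply: nneseries_lim_ge => k _ _; rewrite lee_fin stage_costE.
exact: unit_stage_ge0.
Qed.

Lemma total_cost_ge0 y u : (0 <= total_cost P y u)%E.
Proof.
apply: nneseries_ge0 => k _ _; rewrite lee_fin stage_costE.
exact: unit_stage_ge0.
Qed.

Lemma total_le y u (B : R) :
  (forall n, \sum_(0 <= t < n) unit_stage (yhat P y) (uhat P u) t <= B) ->
  (total_cost P y u <= B%:E)%E.
Proof.
move=> hB; apply: lime_le.
  apply: is_cvg_nneseries => k _ _; rewrite lee_fin stage_costE.
  exact: unit_stage_ge0.
apply: nearW => n; rewrite sumEFin lee_fin.
by under eq_bigr do rewrite stage_costE.
Qed.

(** * Optimality and uniqueness of the closed loop *)

Section Minimizer.
Variables (y0 : nat -> R) (upast d : nat -> int -> R) (L : nat).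
Hypothesis hd : forall (i : nat) (s : int), (1 <= i <= N)%N ->
  L%:Z < s -> d i s = 0.
Variables (y : nat -> nat -> R) (u : nat -> int -> R).
Hypothesis hf : feasible P y0 upast d y u.
Hypothesis hlaw : forall i t : nat, (1 <= i <= N)%N ->
  u i t%:Z = u_alg P L d y u t i.

Let hu : unit_gain P d (yhat P y) (uhat P u) := feasible_unit_gain hf.

Lemma costate_vanishes (e : R) : 0 < e ->
  exists n0 : nat, forall n, (n0 <= n)%N ->
    2 * costate d y u L (L + n) ^+ 2 / gN <= e.
Proof.
move=> e0; have hg := gN_gt0.
pose D := 2 * (X * m_ P d y u L N) ^+ 2 / gN.
have D0 : 0 <= D.
  by apply: divr_ge0; [rewrite mulr_ge0 ?sqr_ge0|exact: ltW].
have g1 : `|g| < 1 by rewrite ger0_norm ?gpar_ge0 ?gpar_lt1.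
(* [D + 1] is used because [D] may be zero. *)
have /cvgr0Pnorm_lt/(_ (e / (D + 1))) := cvg_expr g1.
have D1 : 0 < D + 1 by apply: ltr_wpDl.
move=> /(_ (divr_gt0 e0 D1))[n0 _ hn0]; exists n0 => n hn.
have := hn0 n hn; rewrite /= ger0_norm ?exprn_ge0 ?gpar_ge0// => hgn.
rewrite (costate_late hd hu hlaw).
have -> : 2 * (X * m_ P d y u L N * g ^+ n) ^+ 2 / gN = D * (g ^+ n * g ^+ n).
  by rewrite /D; field; apply: lt0r_neq0.
have gn0 : 0 <= g ^+ n by rewrite exprn_ge0 ?gpar_ge0.
have gn1 : g ^+ n <= 1 by rewrite exprn_ile1 ?gpar_ge0 ?ltW ?gpar_lt1.
have h1 : g ^+ n * g ^+ n <= g ^+ n by rewrite ler_piMr.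
have h2 : (D + 1) * g ^+ n <= e by rewrite mulrC -ler_pdivlMr// ltW.
apply: le_trans h2; apply: le_trans (ler_wpM2l D0 h1) _.
by rewrite ler_wpM2r// lerDl.
Qed.

(** The conserved quantity of [energy_late] supplies the bound. Finiteness rules out a minimizer of
    infinite cost in the uniqueness proof. *)
Lemma closed_loop_finite : exists B : R, (total_cost P y u <= B%:E)%E.
Proof.
exists (energy (yhat P y) (uhat P u) (S + L) + X * m_ P d y u L N ^+ 2
  - initial_excess (yhat P y)).
apply: total_le => n; rewrite lerBrDl.
apply: le_trans (partial_le_energy _ _ _) _.
rewrite -(energy_late hd hu hlaw n).
apply: le_trans (energy_homo _ _ (_ : (S + n <= S + (L + n))%N)) _;
  first by lia.
by rewrite lerDl mulr_ge0 ?sqr_ge0// ltW// Xpar_gt0.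
Qed.

(** [energy_lower_bound] at a late time, with the costate term made arbitrarily small. Dropping the
    energy of the difference gives optimality; keeping it gives uniqueness. *)
Lemma closed_loop_gap (y' : nat -> nat -> R) (u' : nat -> int -> R) (B : R) :
  feasible P y0 upast d y' u' -> (total_cost P y' u' <= B%:E)%E ->
  forall n k,
  \sum_(0 <= t < n) unit_stage (yhat P y) (uhat P u) t
  + energy (fun i t => yhat P y' i t - yhat P y i t)
           (fun i s => uhat P u' i s - uhat P u i s) k / 2 <= B.
Proof.
move=> hf' hB n k.
have [_ i1 p1 _] := hf; have [_ i2 p2 _] := hf'.
have hu' := feasible_unit_gain hf'.
have hy0 i : (1 <= i <= N)%N -> yhat P y' i 0 = yhat P y i 0.
  move=> hi; rewrite /yhat; case: eqP => [i1'|_]; last by rewrite i1// i2.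
  by rewrite i1 ?i2 ?hN.
have hu0 i s : (1 <= i <= N)%N -> s < 0 -> uhat P u' i s = uhat P u i s.
  by move=> hi hs; rewrite /uhat p1// p2.
apply/ler_addgt0Pr => e e0; have [n0 hn0] := costate_vanishes e0.
pose K := (n0 + n + k)%N; have {}hn0 := hn0 K ltac:(lia).
have hnK : (S + n <= S + (L + K))%N by lia.
have hkK : (k <= S + (L + K))%N by lia.
have h1 := energy_lower_bound hd hu hlaw hu' hy0 hu0 (L + K).
have h2 := partial_le_energy (yhat P y) (uhat P u) n.
have h3 := energy_homo (yhat P y) (uhat P u) hnK.
have h4 := energy_le_partial (yhat P y') (uhat P u') (S + (L + K)).
have h5 := le_trans (partial_le_total y' u' (S + (L + K))) hB.
rewrite lee_fin in h5.
have h6 := energy_homo (fun i t => yhat P y' i t - yhat P y i t)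
  (fun i s => uhat P u' i s - uhat P u i s) hkK.
have h7 : initial_excess (yhat P y') = initial_excess (yhat P y).
  by rewrite /initial_excess !big_nat; apply: eq_bigr => i hi; rewrite hy0.
rewrite h7 in h4; lra.
Qed.

Lemma closed_loop_minimizing : minimizing P y0 upast d y u.
Proof.
split=> // y' u' hf'.
have := total_cost_ge0 y' u'.
case E : (total_cost P y' u') => [B| |] // _; last by rewrite leey.
apply: total_le => n.
have := @closed_loop_gap y' u' B hf' _ n 0; rewrite E lexx => /(_ isT).
by apply: le_trans; rewrite lerDl divr_ge0 ?energy_ge0.
Qed.

Lemma minimizing_unique (y' : nat -> nat -> R) (u' : nat -> int -> R) :
  minimizing P y0 upast d y' u' ->
  (forall i t, (1 <= i <= N)%N -> y' i t = y i t) /\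
  (forall i s, (1 <= i <= N)%N -> u' i s = u i s).
Proof.
move=> [hf' hmin]; have hle := hmin _ _ hf.
have [B0 hB0] := closed_loop_finite.
have := total_cost_ge0 y' u'.
case E : (total_cost P y' u') (le_trans hle hB0) => [B| |] // _ _.
set h := fun i t => yhat P y' i t - yhat P y i t.
set v := fun i s => uhat P u' i s - uhat P u i s.
have hz k : energy h v k <= 0.
  (* A positive energy would make the closed loop strictly cheaper than the minimizer. *)
  have hle2 : (total_cost P y u <= (B - energy h v k / 2)%:E)%E.
    apply: total_le => n; rewrite lerBrDr.
    by apply: closed_loop_gap hf' _ n k; rewrite E.
  have := le_trans hle hle2; rewrite E lee_fin; lra.
have [h0 vN0] := unit_stage_eq0 hz.
have [_ _ p1 _] := hf; have [_ _ p2 _] := hf'.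
have hh : unit_gain P (fun _ _ => 0) h v.
  exact (difference_unit_gain hu (feasible_unit_gain hf')).
(* Descent from pool [N]: with zero levels and zero inflow, the dynamics force zero outflow; at time
   [t + T] they involve the outflow of time [t]. *)
have v0 j : (j < N)%N -> forall s, v (N - j)%N s = 0.
  elim: j => [|j IH] hj [t|t].
  - by rewrite subn0 vN0.
  - by rewrite /v /uhat p1 ?p2 ?subrr//; lia.
  - have [_ dyn] := hh; have hj1 : (1 <= N - j <= N)%N by lia.
    have := dyn (N - j)%N (t + T)%N hj1.
    rewrite !h0// dhat0 IH; last by lia.
    have -> : (N - j).-1 = (N - j.+1)%N by lia.
    have -> : (t + T)%N%:Z - T%:Z = t%:Z by lia.
    by rewrite !addr0 add0r => /eqP; rewrite eq_sym oppr_eq0 => /eqP.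
  - by rewrite /v /uhat p1 ?p2 ?subrr//; lia.
split=> [i t hi|i s hi].
  have := h0 i t hi; rewrite /h /yhat; case: eqP => [->|/eqP i1] /subr0_eq //.
  apply: mulfI; rewrite mulf_neq0 ?invr_neq0 ?lt0r_neq0 ?bhat_gt0 ?hc//; lia.
have := v0 (N - i)%N ltac:(lia) s; rewrite subKn; last by lia.
by move=> /subr0_eq; apply: mulfI; rewrite lt0r_neq0 ?bhat_gt0.
Qed.

End Minimizer.

End Optimality.

(** * Construction of the closed loop, and causality of the law *)

Section ClosedLoopExistence.
Variables (R : realType) (P : pool_string R).
Local Notation N := (nb_pools P).

Variables (y0 : nat -> R) (upast d : nat -> int -> R) (L : nat).

Definition loop_start : (nat -> R) * (nat -> int -> R) :=
  (y0, fun i s => if i == 0%N then 0 else upast i s).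

(** The current levels are passed to the law as a function constant in time, since it reads them
    only at [t]. Inputs are updated before levels: if [taubar] is 0, the outflow at [t] acts at
    once. *)
Definition loop_step (t : nat) (x : (nat -> R) * (nat -> int -> R)) :
    (nat -> R) * (nat -> int -> R) :=
  let u i (s : int) :=
    if (1 <= i)%N && (s == t%:Z) then u_alg P L d (fun j _ => x.1 j) x.2 t i
    else x.2 i s in
  (fun i => x.1 i + b_ P i * u i (t%:Z - (tau_ P i)%:Z - (taubar P)%:Z)
     - c_ P i * (u i.-1 (t%:Z - (taubar P)%:Z) - d i (t%:Z - (taubar P)%:Z)),
   u).

(* The levels at time [t] and the inputs before time [t]. *)
Fixpoint loop_state (t : nat) : (nat -> R) * (nat -> int -> R) :=
  if t is s.+1 then loop_step s (loop_state s) else loop_start.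

Definition loop_level (i t : nat) : R := (loop_state t).1 i.

Definition loop_input (i : nat) (s : int) : R :=
  if s is Posz t then (loop_state t.+1).2 i s else (loop_state 0).2 i s.

(** Each step writes only the inputs of its own time, so stored ones never change. *)
Lemma loop_stateE (t n i : nat) (s : int) : s < t%:Z ->
  (loop_state (t + n)).2 i s = (loop_state t).2 i s.
Proof.
move=> hs; elim: n => [|n IH]; first by rewrite addn0.
by rewrite addnS /= IH; case: ifP => // /andP[_ /eqP]; lia.
Qed.

Lemma loop_past (t i : nat) (s : int) : s < t%:Z ->
  (loop_state t).2 i s = loop_input i s.
Proof.
case: s => [s|s] hs; last by rewrite -[t]add0n loop_stateE.
have -> : t = (s.+1 + (t - s.+1))%N by lia.
by rewrite /loop_input (@loop_stateE s.+1)//; lia.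
Qed.

Lemma loop_feasible : feasible P y0 upast d loop_level loop_input.
Proof.
split.
- have h t s : (loop_state t).2 0%N s = 0 by elim: t => [|t IH].
  by case=> s; exact: h.
- by [].
- by case=> [//|i] [s|s] hi hs.
- move=> i t hi; rewrite -!(@loop_past t.+1) //; lia.
Qed.

Hypothesis hN : (1 <= nb_pools P)%N.
Hypothesis htau : forall i : nat, (1 <= i <= nb_pools P)%N -> (1 <= tau_ P i)%N.

Section Causality.
Variable t : nat.
Variables (y y' : nat -> nat -> R) (u u' : nat -> int -> R).
Hypothesis hy : forall i, (1 <= i <= N)%N -> y i t = y' i t.
Hypothesis hu : forall i (s : int), (i <= N)%N -> s < t%:Z -> u i s = u' i s.

Let uhat_past i (s : int) :
  (i <= N)%N -> s < t%:Z -> uhat P u i s = uhat P u' i s.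
Proof. by move=> hi hs; rewrite /uhat hu. Qed.

Let yhat_now i : (1 <= i <= N)%N -> yhat P y i t = yhat P y' i t.
Proof. by move=> hi; rewrite /yhat !hy ?hN. Qed.

Lemma p_causal i : (1 <= i <= N)%N -> p_ P d y u t i = p_ P d y' u' t i.
Proof.
move=> hi; have ti := htau hi; rewrite /p_ yhat_now//.
congr (_ + _ - _ + _); rewrite !big_nat; apply: eq_bigr => s hs.
- by apply: uhat_past; lia.
- by apply: uhat_past; lia.
Qed.

Lemma m_causal i : (1 <= i <= N)%N -> m_ P d y u t i = m_ P d y' u' t i.
Proof.
elim: i => [//|[_ h1|i IH hi]].
  rewrite /= yhat_now//; congr (_ + _ + _ + _); rewrite !big_nat.
  by apply: eq_bigr => s hs; apply: uhat_past; lia.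
rewrite [LHS]/= [RHS]/= -/(m_ P d y u t i.+1) -/(m_ P d y' u' t i.+1).
rewrite IH ?p_causal//; last by lia.
congr (_ + _ + _ + _); rewrite !big_nat.
by apply: eq_bigr => s hs; apply: uhat_past; lia.
Qed.

(** Allows replacing the stored history by the whole trajectory in [loop_law], and the closed loop
    by a given minimizer in the theorem. *)
Lemma u_alg_causal i : (1 <= i <= N)%N ->
  u_alg P L d y u t i = u_alg P L d y' u' t i.
Proof.
move=> hi; rewrite /u_alg /uhat_alg; case: eqP => [_|/eqP iN].
  by rewrite m_causal// hN leqnn.
by rewrite m_causal// p_causal//; lia.
Qed.

End Causality.

Lemma loop_law (i t : nat) : (1 <= i <= N)%N ->
  loop_input i t%:Z = u_alg P L d loop_level loop_input t i.
Proof.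
move=> hi; rewrite {1}/loop_input /= eqxx andbT; case: ifP; last by lia.
by move=> _; apply: u_alg_causal => // j s _ hs; exact: loop_past.
Qed.

End ClosedLoopExistence.

Theorem theorem1 (R : realType) (P : pool_string R)
    (hN : (1 <= nb_pools P)%N)
    (hb : forall i : nat, (1 <= i <= nb_pools P)%N -> 0 < b_ P i)
    (hc : forall i : nat, (1 <= i <= nb_pools P)%N -> 0 < c_ P i)
    (htau : forall i : nat, (1 <= i <= nb_pools P)%N -> (1 <= tau_ P i)%N)
    (hq : forall i : nat, (1 <= i <= nb_pools P)%N -> 0 < q_ P i)
    (hr0 : forall i : nat, (1 <= i < nb_pools P)%N -> r_ P i = 0)
    (hrN : 0 < r_ P (nb_pools P))
    (hrho : forall i : nat, (1 <= i <= nb_pools P)%N -> rho_ P i = 0)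
    (y0 : nat -> R) (upast d : nat -> int -> R)
    (t H : nat) (hH : (0 < H)%N)
    (hd : forall (i : nat) (s : int), (1 <= i <= nb_pools P)%N ->
            t%:Z + H%:Z < s -> d i s = 0) :
  (exists (y : nat -> nat -> R) (u : nat -> int -> R),
      minimizing P y0 upast d y u) /\
  forall (y : nat -> nat -> R) (u : nat -> int -> R),
    minimizing P y0 upast d y u ->
    [/\ forall i : nat, (1 <= i <= nb_pools P)%N ->
          u i t%:Z = u_alg P H d y u t i,
        forall i : nat, (2 <= i <= nb_pools P)%N ->
          u i.-1 t%:Z =
            1 / bhat P i.-1 *
            ((1 - gamma P i / qhat P i) * p_ P d y u t i
             - gamma P i / qhat P i * m_ P d y u t i.-1)
      & u (nb_pools P) t%:Z =
          - (1 / bhat P (nb_pools P)) * (Xpar P / rhat P) *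
          (m_ P d y u t (nb_pools P)
           + \sum_((tau_ P (nb_pools P)).+1 <= s < H.+1)
               gpar P ^+ (s - tau_ P (nb_pools P)) *
               Dagg P d (nb_pools P)
                 (t%:Z + (sigma P (nb_pools P))%:Z + s%:Z))].
Proof.
have hd' (i : nat) (s : int) : (1 <= i <= nb_pools P)%N ->
    (t + H)%N%:Z < s -> d i s = 0.
  by move=> hi hs; apply: hd => //; lia.
(* The loop runs at all times with horizon [t + H]; [hpreview] restores [H] at time [t]. *)
have hf := loop_feasible P y0 upast d (t + H).
have hlaw := loop_law y0 upast d (t + H) hN htau.
have hmin := closed_loop_minimizing hN hb hc htau hq hrN hr0 hrho hd' hf hlaw.
split=> [|y u hyu]; first by do 2 eexists; exact: hmin.
have [ey eu] := minimizing_unique hN hb hc htau hq hrN hr0 hrho hd' hf hlaw hyu.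
have [[u0 _ _ _] _] := hyu; have [l0 _ _ _] := hf.
have hpreview : preview P d (t + H) t = preview P d H t.
  exact: preview_horizon.
have main (i : nat) : (1 <= i <= nb_pools P)%N ->
    u i t%:Z = u_alg P H d y u t i.
  move=> hi; rewrite eu// hlaw//.
  have -> : u_alg P H d y u t i = u_alg P (t + H) d y u t i.
    by rewrite /u_alg /uhat_alg -!/(preview P d _ t) hpreview.
  apply: u_alg_causal => // [j hj|j s hj hs]; first by rewrite ey.
  (* Uniqueness says nothing of index 0, where both inputs are zero by feasibility. *)
  by case: j hj => [_|j hj]; [rewrite u0 l0|rewrite eu].
split=> [//|[//|[//|i]] hi|].
  rewrite succnK main; last by lia.
  rewrite /u_alg /uhat_alg; have -> : (i.+1 == nb_pools P) = false by lia.
  by rewrite mulrC mul1r.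
rewrite main ?hN ?leqnn// /u_alg /uhat_alg eqxx; ring.
Qed.
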